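(* Let $R$ and $R'$ be commutative unital rings, $\mathcal{S}$ a simplicially enriched category and $n\ge 0$ an integer. There exists a unique ($s$-unital) $R[\mathcal{S}]$-$R'[\mathcal{S}]$-bimodule structure on the $R$-$R'$-bimodule $C_n(R,\mathcal{S},R')$ such that for all $1$-morphisms $f:X\to Y$ and $g:U\to V$ of $\mathcal{S}$, all objects $A,B$ of $\mathcal{S}$ and all $\sigma\in(\mathcal{S}(A,B))_n$, $$f\times\sigma\times g=\begin{cases}0 & \text{if } V\neq A \text{ or } B\neq X,\\ (s_{n-1}\cdots s_0)(f)\circ_n\sigma\circ_n(s_{n-1}\cdots s_0)(g) & \text{otherwise,}\end{cases}$$ where $f\times\sigma\times g$ denotes the result of acting on $\sigma$ on the left by $f\in R[\mathcal{S}]$ and on the right by $g\in R'[\mathcal{S}]$.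
   Context: A simplicially enriched category $\mathcal{S}$ (with a set of objects) is a category enriched over simplicial sets: for objects $A,B$ there is a simplicial set $\mathcal{S}(A,B)$, and composition $\mathcal{S}(A,B)\times\mathcal{S}(B,C)\to\mathcal{S}(A,C)$, $(f,g)\mapsto g\circ f$, is a simplicial map; $\circ_n$ denotes its restriction to $n$-simplices. A $1$-morphism $f:X\to Y$ is a $0$-simplex of $\mathcal{S}(X,Y)$; the $1$-morphisms form a category $\mathcal{S}_0$ under $\circ_0$. $s_k$ denotes the degeneracy operators of any simplicial set, so $(s_{n-1}\cdots s_0)(f)\in(\mathcal{S}(X,Y))_n$ (it is $f$ if $n=0$). For a commutative unital ring $R$, the path algebra $R[\mathcal{S}]$ is the free left $R$-module on all $1$-morphisms, with $R$-bilinear product determined, for $f:X\to Y$, $g:Z\to T$, by $g\times f=g\circ_0 f$ if $Z=Y$ and $0$ otherwise; it is a (generally non-unital) $R$-algebra. $C_n(R,\mathcal{S},R')$ is the free $R$-$R'$-bimodule (direct sum of copies of $R\otimes_{\mathbb{Z}}R'$) on the set $\bigcup_{A,B}(\mathcal{S}(A,B))_n$ of all $n$-simplices of all hom-objects. For an $R$-algebra $\mathbb{A}$ and an $R'$-algebra $\mathbb{B}$ (non-unital allowed), an $\mathbb{A}$-$\mathbb{B}$-bimodule structure on an $R$-$R'$-bimodule $M$ consists of biadditive associative actions of $\mathbb{A}$ on the left and of $\mathbb{B}$ on the right, with $r.(a.m)=(r.a).m=a.(r.m)$ and $(m.b).r'=m.(r'.b)=(m.r').b$ for $r\in R$, $r'\in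 R'$, and such that the left actions of $\mathbb{A},R$ commute with the right actions of $\mathbb{B},R'$. It is $s$-unital if for every $m\in M$ there are $e\in\mathbb{A}$, $e'\in\mathbb{B}$ with $e.m=m$ and $m.e'=m$. *)

(* Defs.v *)
From HB Require Import structures.
From mathcomp Require Import all_boot all_algebra.
From mathcomp Require Import boolp finmap.
From mathcomp.multinomials Require Import monalg.

Set Implicit Arguments.
Unset Strict Implicit.
Unset Printing Implicit Defensive.

Import GRing.Theory.
Local Open Scope ring_scope.
Local Open Scope quotient_scope.

(* In the simplicial identities, [widen_ord (leqnSn _) i] is the index [i], and
   [lift ord0 j] the index [j + 1], in the next larger ordinal. *)
Record sset := SSet {
  simp :> nat -> Type;
  face : forall n, 'I_n.+2 -> simp n.+1 -> simp n;
  degen : forall n, 'I_n.+1 -> simp n -> simp n.+1;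
  face_face : forall n (i j : 'I_n.+2) (x : simp n.+2), (i <= j)%N ->
    face i (face (lift ord0 j) x) = face j (face (widen_ord (leqnSn _) i) x);
  face_degen_lt : forall n (i : 'I_n.+2) (j : 'I_n.+1) (x : simp n.+1),
    (i <= j)%N ->
    face (widen_ord (leqnSn _) i) (degen (lift ord0 j) x) = degen j (face i x);
  face_degen_id : forall n (j : 'I_n.+1) (x : simp n),
    face (widen_ord (leqnSn _) j) (degen j x) = x;
  face_degen_idS : forall n (j : 'I_n.+1) (x : simp n),
    face (lift ord0 j) (degen j x) = x;
  face_degen_gt : forall n (i : 'I_n.+2) (j : 'I_n.+1) (x : simp n.+1),
    (j < i)%N ->
    face (lift ord0 i) (degen (widen_ord (leqnSn _) j) x) = degen j (face i x);
  degen_degen : forall n (i j : 'I_n.+1) (x : simp n), (i <= j)%N ->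
    degen (widen_ord (leqnSn _) i) (degen j x) =
    degen (lift ord0 j) (degen i x)
}.

(* [total_degen n f] is [s_{n-1} ... s_0 f]. *)
Fixpoint total_degen (X : sset) (n : nat) (f : X 0%N) : X n :=
  if n is m.+1 then degen (@ord_max m) (total_degen m f) else f.

(* The unit of a category enriched over simplicial sets is a simplicial map
   from the terminal simplicial set to [hom A A]; [ident A n] is the image of
   the unique [n]-simplex. *)
Record scat := SCat {
  obj :> Type;
  hom : obj -> obj -> sset;
  comp : forall A B C n, hom B C n -> hom A B n -> hom A C n;
  ident : forall A n, hom A A n;
  comp_face : forall A B C n (i : 'I_n.+2) (g : hom B C n.+1)
      (f : hom A B n.+1),
    face i (comp g f) = comp (face i g) (face i f);
  comp_degen : forall A B C n (i : 'I_n.+1) (g : hom B C n) (f : hom A B n),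
    degen i (comp g f) = comp (degen i g) (degen i f);
  ident_face : forall A n (i : 'I_n.+2), face i (ident A n.+1) = ident A n;
  ident_degen : forall A n (i : 'I_n.+1), degen i (ident A n) = ident A n.+1;
  compA : forall A B C D n (h : hom C D n) (g : hom B C n) (f : hom A B n),
    comp h (comp g f) = comp (comp h g) f;
  comp1s : forall A B n (f : hom A B n), comp (ident B n) f = f;
  comps1 : forall A B n (f : hom A B n), comp f (ident A n) = f
}.

Record simplex (S : scat) (n : nat) := Simplex {
  src : S;
  tgt : S;
  simplex_val : hom src tgt n
}.

(* [scomp y x] is [y] after [x] when these are composable, and [None]
   otherwise. *)
Definition scomp (S : scat) (n : nat) (y x : simplex S n) :
    option (simplex S n) :=
  match pselect (tgt x = src y) with
  | left e => Some (Simplex (comp (simplex_val y)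
      (eq_rect _ (fun B => hom (src x) B n) (simplex_val x) _ e)))
  | right _ => None
  end.

(* Finitely supported functions need a [choiceType] of indices; objects of [S]
   form an arbitrary type, so the choice structure is the classical one. *)
Definition csimplex (S : scat) (n : nat) : choiceType := {classic (simplex S n)}.

Section SimplexComposition.
Variables (S : scat) (n : nat).
Implicit Types x y z : simplex S n.

Lemma scompE (A B C : S) (g : hom B C n) (f : hom A B n) :
  scomp (Simplex g) (Simplex f) = Some (Simplex (comp g f)).
Proof.
rewrite /scomp /=; case: pselect => [e|//].
by rewrite (Prop_irrelevance e erefl).
Qed.

Lemma scomp_none y x : tgt x <> src y -> scomp y x = None.
Proof. by rewrite /scomp; case: pselect. Qed.

Lemma scompA x y z :
  obind (scomp x) (scomp y z) = obind (fun u => scomp u z) (scomp x y).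
Proof.
case: x => [B1 D h]; case: y => [A1 B g]; case: z => [A0 A f].
have [eA|nA] := pselect (A = A1); have [eB|nB] := pselect (B = B1).
- by case: _ / eA in g *; case: _ / eB in h *; rewrite !scompE /= !scompE compA.
- case: _ / eA in g *.
  by rewrite scompE (@scomp_none (Simplex h) (Simplex g)) //= scomp_none.
- case: _ / eB in h *.
  by rewrite scompE (@scomp_none (Simplex g) (Simplex f)) //= scomp_none.
- by rewrite (@scomp_none (Simplex g) (Simplex f)) ?(@scomp_none (Simplex h)).
Qed.

End SimplexComposition.

Section MalgLift.
Variables (K : choiceType) (G : zmodType).

Lemma malg_gen_ind (P : {malg G[K]} -> Prop) :
  P 0 -> (forall a b, P a -> P b -> P (a + b)) ->
  (forall k x, P << x *g k >>) -> forall a, P a.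
Proof. by move=> P0 PD PU a; rewrite [a]monalgE; apply: big_ind. Qed.

Definition malg_lift (V : zmodType) (h : K -> G -> V) (a : {malg G[K]}) : V :=
  \sum_(k <- msupp a) h k a@_k.

Variables (V : zmodType) (h : K -> G -> V).
Hypothesis hD : forall k, {morph h k : x y / x + y}.

Lemma morphD0 (U W : zmodType) (f : U -> W) : {morph f : x y / x + y} -> f 0 = 0.
Proof. by move=> fD; apply: (@addrI _ (f 0)); rewrite -fD !addr0. Qed.

Lemma morphDB (U W : zmodType) (f : U -> W) :
  {morph f : x y / x + y} -> {morph f : x y / x - y}.
Proof.
by move=> fD x y; apply: (@addIr _ (f y)); rewrite -fD !subrK.
Qed.

Lemma malg_liftEw (d : {fset K}) a : (msupp a `<=` d)%fset ->
  malg_lift h a = \sum_(k <- d) h k a@_k.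
Proof.
move=> ad; rewrite /malg_lift (big_fset_incl _ ad) // => k _ /mcoeff_outdom ->.
exact: morphD0.
Qed.

Lemma malg_liftD : {morph malg_lift h : a b / a + b}.
Proof.
move=> a b; rewrite (malg_liftEw (msuppD_le a b)).
rewrite (malg_liftEw (fsubsetUl (msupp a) (msupp b))).
rewrite (malg_liftEw (fsubsetUr (msupp a) (msupp b))) -big_split /=.
by apply: eq_bigr => k _; rewrite mcoeffD hD.
Qed.

Lemma malg_liftU k x : malg_lift h << x *g k >> = h k x.
Proof. by rewrite (malg_liftEw msuppU_le) big_seq_fset1 mcoeffUU. Qed.

End MalgLift.

Definition is_bimodule (R R' : comPzRingType) (M : zmodType)
    (l : R -> M -> M) (r : M -> R' -> M) : Prop :=
  [/\ [/\ forall a b m, l (a + b) m = l a m + l b m,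
          forall a m m', l a (m + m') = l a m + l a m',
          forall a b m, l (a * b) m = l a (l b m) &
          forall m, l 1 m = m],
      [/\ forall m a b, r m (a + b) = r m a + r m b,
          forall m m' a, r (m + m') a = r m a + r m' a,
          forall m a b, r m (a * b) = r (r m a) b &
          forall m, r m 1 = m] &
      forall a m b, l a (r m b) = r (l a m) b].

Record bimodule (R R' : comPzRingType) := Bimodule {
  bimod_sort :> zmodType;
  lscale : R -> bimod_sort -> bimod_sort;
  rscale : bimod_sort -> R' -> bimod_sort;
  bimoduleP : is_bimodule lscale rscale
}.

Definition is_algebra (R : comPzRingType) (A : zmodType)
    (scale : R -> A -> A) (mul : A -> A -> A) : Prop :=
  [/\ [/\ forall r s a, scale (r + s) a = scale r a + scale s a,
          forall r a b, scale r (a + b) = scale r a + scale r b,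
          forall r s a, scale (r * s) a = scale r (scale s a) &
          forall a, scale 1 a = a],
      [/\ forall a b c, mul (a + b) c = mul a c + mul b c,
          forall a b c, mul a (b + c) = mul a b + mul a c,
          forall r a b, mul (scale r a) b = scale r (mul a b) &
          forall r a b, mul a (scale r b) = scale r (mul a b)] &
      associative mul].

(* Associative algebras, not necessarily unital. *)
Record nualgebra (R : comPzRingType) := NuAlgebra {
  nualg_sort :> zmodType;
  nualg_scale : R -> nualg_sort -> nualg_sort;
  nualg_mul : nualg_sort -> nualg_sort -> nualg_sort;
  nualgebraP : is_algebra nualg_scale nualg_mul
}.

Section PathAlgebra.
Variables (R : comPzRingType) (S : scat).

Local Notation T := ({malg R[csimplex S 0]}).

Definition path_scale (r : R) : T -> T :=
  malg_lift (fun f x => << r * x *g f >>).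

Definition path_term (c : R) (o : option (simplex S 0)) : T :=
  if o is Some h then << c *g (h : csimplex S 0) >> else 0.

Definition path_mul (b a : T) : T :=
  \sum_(g <- msupp b) \sum_(f <- msupp a) path_term (b@_g * a@_f) (scomp g f).

Lemma path_termD o : {morph path_term^~ o : x y / x + y}.
Proof. by case: o => [h|] x y /=; rewrite ?addr0 // monalgUD. Qed.

Lemma path_scale_D r k : {morph (fun x : R => << r * x *g k >> : T) : x y / x + y}.
Proof. by move=> x y; rewrite mulrDr monalgUD. Qed.

Lemma path_scaleD r : {morph path_scale r : a b / a + b}.
Proof. exact: malg_liftD (path_scale_D r). Qed.

Lemma path_scaleU r x k : path_scale r << x *g k >> = << r * x *g k >>.
Proof. exact: malg_liftU (path_scale_D r) _ _. Qed.

Lemma path_scale_term r c o :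
  path_scale r (path_term c o) = path_term (r * c) o.
Proof.
case: o => [h|] /=; first exact: path_scaleU.
exact: morphD0 (path_scaleD r).
Qed.

Definition path_mul_in (g : csimplex S 0) (y : R) (a : T) : T :=
  malg_lift (fun (f : csimplex S 0) x => path_term (y * x) (scomp g f)) a.

Lemma path_mul_in_D g y (f : csimplex S 0) :
  {morph (fun x => path_term (y * x) (scomp g f)) : x x' / x + x'}.
Proof. by move=> x x'; rewrite mulrDr path_termD. Qed.

Lemma path_mul_in_Dl a g : {morph (path_mul_in g)^~ a : x y / x + y}.
Proof.
move=> x y; rewrite /path_mul_in /malg_lift -big_split /=.
by apply: eq_bigr => k _; rewrite mulrDl path_termD.
Qed.

Lemma path_mulDl a b c : path_mul (a + b) c = path_mul a c + path_mul b c.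
Proof. exact: malg_liftD (path_mul_in_Dl c) a b. Qed.

Lemma path_mulDr a b c : path_mul a (b + c) = path_mul a b + path_mul a c.
Proof.
rewrite -big_split /=; apply: eq_bigr => g _.
exact: (malg_liftD (path_mul_in_D g a@_g)).
Qed.

Lemma path_mulUU y g x f :
  path_mul << y *g g >> << x *g f >> = path_term (y * x) (scomp g f).
Proof.
rewrite [LHS](malg_liftU (path_mul_in_Dl _)).
exact: (malg_liftU (path_mul_in_D g y)).
Qed.

Lemma path_mul0l a : path_mul 0 a = 0.
Proof. by apply: (@morphD0 _ _ (path_mul^~ a)) => b c; apply: path_mulDl. Qed.

Lemma path_mul0r a : path_mul a 0 = 0.
Proof. by apply: (@morphD0 _ _ (path_mul a)) => b c; apply: path_mulDr. Qed.

Lemma path_scale0 r : path_scale r 0 = 0.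
Proof. exact: morphD0 (path_scaleD r). Qed.

Lemma path_algebraP : is_algebra path_scale path_mul.
Proof.
split; [split|split|].
- move=> r s a; elim/malg_gen_ind: a => [|a b Ha Hb|k x].
  + by rewrite !path_scale0 addr0.
  + by rewrite !path_scaleD Ha Hb addrACA.
  + by rewrite !path_scaleU mulrDl monalgUD.
- by move=> r a b; rewrite path_scaleD.
- move=> r s a; elim/malg_gen_ind: a => [|a b Ha Hb|k x].
  + by rewrite !path_scale0.
  + by rewrite !path_scaleD Ha Hb.
  + by rewrite !path_scaleU mulrA.
- move=> a; elim/malg_gen_ind: a => [|a b Ha Hb|k x].
  + by rewrite !path_scale0.
  + by rewrite !path_scaleD Ha Hb.
  + by rewrite !path_scaleU mul1r.
- exact: path_mulDl.
- exact: path_mulDr.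
- move=> r a b; elim/malg_gen_ind: a => [|a a' Ha Ha'|g y].
  + by rewrite path_scale0 !path_mul0l path_scale0.
  + by rewrite path_scaleD !path_mulDl path_scaleD Ha Ha'.
  elim/malg_gen_ind: b => [|b b' Hb Hb'|f x].
  + by rewrite !path_mul0r path_scale0.
  + by rewrite !path_mulDr path_scaleD Hb Hb'.
  + by rewrite path_scaleU !path_mulUU path_scale_term mulrA.
- move=> r a b; elim/malg_gen_ind: a => [|a a' Ha Ha'|g y].
  + by rewrite !path_mul0l path_scale0.
  + by rewrite !path_mulDl path_scaleD Ha Ha'.
  elim/malg_gen_ind: b => [|b b' Hb Hb'|f x].
  + by rewrite path_scale0 !path_mul0r path_scale0.
  + by rewrite path_scaleD !path_mulDr path_scaleD Hb Hb'.
  + by rewrite path_scaleU !path_mulUU path_scale_term mulrCA.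
- move=> a b c; elim/malg_gen_ind: a => [|a a' Ha Ha'|h z].
  + by rewrite !path_mul0l.
  + by rewrite !path_mulDl Ha Ha'.
  elim/malg_gen_ind: b => [|b b' Hb Hb'|g y].
  + by rewrite !(path_mul0l, path_mul0r).
  + by rewrite !(path_mulDl, path_mulDr) Hb Hb'.
  elim/malg_gen_ind: c => [|c c' Hc Hc'|f x].
  + by rewrite !path_mul0r.
  + by rewrite !path_mulDr Hc Hc'.
  rewrite !path_mulUU; have := scompA h g f.
  case: (scomp g f) => [u|]; case: (scomp h g) => [v|] //=.
  + by rewrite !path_mulUU mulrA => ->.
  + by rewrite path_mulUU path_mul0l => ->.
  + by rewrite path_mulUU path_mul0r => <-.
  + by rewrite path_mul0l path_mul0r.
Qed.

Definition path_algebra : nualgebra R := NuAlgebra path_algebraP.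

Definition path_gen (X Y : S) (f : hom X Y 0) : path_algebra :=
  (<< (Simplex f : csimplex S 0) >> : T).

End PathAlgebra.

Section Tensor.
Variables (R R' : comPzRingType).

Local Notation F := ({malg int[(R * R')%type]}).

Inductive tensor_null : F -> Prop :=
| tensor_nullDl x x' y :
    tensor_null (<< (x + x', y) >> - << (x, y) >> - << (x', y) >>)
| tensor_nullDr x y y' :
    tensor_null (<< (x, y + y') >> - << (x, y) >> - << (x, y') >>)
| tensor_null0 : tensor_null 0
| tensor_nullB u v : tensor_null u -> tensor_null v -> tensor_null (u - v).

Definition tensor_relations : {pred F} := fun u => `[< tensor_null u >].

Lemma tensor_relations_closed : zmod_closed tensor_relations.
Proof.
split=> [|u v]; rewrite !unfold_in; first by apply/asboolP; exact: tensor_null0.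
by move=> /asboolP Hu /asboolP Hv; apply/asboolP; exact: tensor_nullB.
Qed.

HB.instance Definition _ :=
  GRing.isZmodClosed.Build F tensor_relations tensor_relations_closed.

(* The tensor product of [R] and [R'] over the integers. *)
Definition tensor : zmodType := Quotient.quot tensor_relations.

Definition tens (x : R) (y : R') : tensor := \pi << (x, y) >>.

Definition tensor_lift (V : zmodType) (b : R -> R' -> V) (t : tensor) : V :=
  malg_lift (fun p (z : int) => b p.1 p.2 *~ z) (repr t).

Lemma pi_tensorD : {morph (\pi_tensor : F -> tensor) : u v / u + v}.
Proof. by move=> u v; rewrite piE. Qed.

Lemma tens_rel u v : tensor_null (u - v) -> \pi_tensor u = \pi_tensor v.
Proof.
move=> uv; apply/eqP; rewrite -Quotient.idealrBE unfold_in.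
exact/asboolP.
Qed.

Lemma tensDl x x' y : tens (x + x') y = tens x y + tens x' y.
Proof.
rewrite /tens -pi_tensorD; apply: tens_rel.
by rewrite opprD addrA; exact: tensor_nullDl.
Qed.

Lemma tensDr x y y' : tens x (y + y') = tens x y + tens x y'.
Proof.
rewrite /tens -pi_tensorD; apply: tens_rel.
by rewrite opprD addrA; exact: tensor_nullDr.
Qed.

Lemma tensor_ind (P : tensor -> Prop) :
  (forall x y, P (tens x y)) -> (forall t u, P t -> P u -> P (t + u)) ->
  forall t, P t.
Proof.
move=> Pt PD t; rewrite -[t]reprK; elim/malg_gen_ind: (repr t) => [|u v Pu Pv|].
- suff <- : tens 0 0 = \pi_tensor 0 by [].
  have /(addrI (tens 0 0)) -> : tens 0 0 + tens 0 0 = tens 0 0 + 0.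
    by rewrite -tensDl !addr0.
  by rewrite (morphD0 pi_tensorD).
- by rewrite pi_tensorD; exact: PD.
move=> [x y] z; suff -> : \pi_tensor << z *g (x, y) >> = tens (x *~ z) y by [].
have piB := morphDB pi_tensorD; pose p : (R * R')%type := (x, y).
have tD : {morph (fun x => tens x y) : a b / a + b} by move=> a b; exact: tensDl.
have tB := morphDB tD.
elim: z => [|n IHn|n IHn].
- by rewrite monalgU0 mulr0z (morphD0 tD) (morphD0 pi_tensorD).
- by rewrite -addn1 PoszD monalgUD pi_tensorD IHn mulrzDr tensDl.
- rewrite -addn1 PoszD opprD monalgUB piB IHn mulrzBr.
  by rewrite (tB (x *~ - n%:Z) (x *~ 1)).
Qed.

Section TensorLift.
Variables (V : zmodType) (b : R -> R' -> V).
Hypothesis bDl : forall y, {morph b^~ y : x x' / x + x'}.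
Hypothesis bDr : forall x, {morph b x : y y' / y + y'}.

Let h (p : (R * R')%type) (z : int) : V := b p.1 p.2 *~ z.

Let hD p : {morph h p : z z' / z + z'}.
Proof. by move=> z z'; rewrite /h mulrzDr. Qed.

Lemma tensor_lift_pi u : tensor_lift b (\pi_tensor u) = malg_lift h u.
Proof.
have nullP v : tensor_null v -> malg_lift h v = 0.
  have hB := morphDB (malg_liftD hD).
  elim=> [x x' y|x y y'||v1 v2 _ v1_0 _ v2_0].
  - by rewrite !hB !malg_liftU // /h /= !mulr1z bDl addrAC addrK subrr.
  - by rewrite !hB !malg_liftU // /h /= !mulr1z bDr addrAC addrK subrr.
  - exact: morphD0 (malg_liftD hD).
  - by rewrite hB v1_0 v2_0 subrr.
apply/eqP; rewrite -subr_eq0 -(morphDB (malg_liftD hD)); apply/eqP/nullP.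
apply/asboolP; have := Quotient.idealrBE tensor_relations (repr (\pi_tensor u)) u.
by rewrite reprK eqxx unfold_in.
Qed.

Lemma tensor_liftD : {morph tensor_lift b : t u / t + u}.
Proof.
move=> t u; rewrite -[t]reprK -[u]reprK -pi_tensorD !tensor_lift_pi.
exact: malg_liftD.
Qed.

Lemma tensor_liftE x y : tensor_lift b (tens x y) = b x y.
Proof. by rewrite tensor_lift_pi malg_liftU // /h mulr1z. Qed.

End TensorLift.

Definition tensor_lscale (r : R) : tensor -> tensor :=
  tensor_lift (fun x y => tens (r * x) y).
Definition tensor_rscale (t : tensor) (r : R') : tensor :=
  tensor_lift (fun x y => tens x (y * r)) t.

Lemma tensor_lscaleD r : {morph tensor_lscale r : t u / t + u}.
Proof.
by apply: tensor_liftD => [y x x'|x y y']; rewrite ?mulrDr (tensDl, tensDr).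
Qed.

Lemma tensor_lscaleE r x y : tensor_lscale r (tens x y) = tens (r * x) y.
Proof.
by apply: tensor_liftE => {x y} [y x x'|x y y'];
  rewrite ?mulrDr (tensDl, tensDr).
Qed.

Lemma tensor_rscaleD r : {morph tensor_rscale^~ r : t u / t + u}.
Proof.
by apply: tensor_liftD => [y x x'|x y y']; rewrite ?mulrDl (tensDl, tensDr).
Qed.

Lemma tensor_rscaleE r x y : tensor_rscale (tens x y) r = tens x (y * r).
Proof.
by apply: (@tensor_liftE _ (fun x y => tens x (y * r))) => {x y} [y x x'|x y y'];
  rewrite ?mulrDl (tensDl, tensDr).
Qed.

Lemma tensor_bimoduleP : is_bimodule tensor_lscale tensor_rscale.
Proof.
split; [split|split|].
- move=> a b; apply: tensor_ind => [x y|t u Ht Hu].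
    by rewrite !tensor_lscaleE mulrDl tensDl.
  by rewrite !tensor_lscaleD Ht Hu addrACA.
- by move=> a t u; exact: tensor_lscaleD.
- move=> a b; apply: tensor_ind => [x y|t u Ht Hu].
    by rewrite !tensor_lscaleE mulrA.
  by rewrite !tensor_lscaleD Ht Hu.
- apply: tensor_ind => [x y|t u Ht Hu]; first by rewrite tensor_lscaleE mul1r.
  by rewrite tensor_lscaleD Ht Hu.
- move=> + a b; apply: tensor_ind => [x y|t u Ht Hu].
    by rewrite !tensor_rscaleE mulrDr tensDr.
  by rewrite !tensor_rscaleD Ht Hu addrACA.
- by move=> t u a; exact: tensor_rscaleD.
- move=> + a b; apply: tensor_ind => [x y|t u Ht Hu].
    by rewrite !tensor_rscaleE mulrA.
  by rewrite !tensor_rscaleD Ht Hu.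
- apply: tensor_ind => [x y|t u Ht Hu]; first by rewrite tensor_rscaleE mulr1.
  by rewrite tensor_rscaleD Ht Hu.
- move=> a + b; apply: tensor_ind => [x y|t u Ht Hu].
    by rewrite tensor_rscaleE !tensor_lscaleE tensor_rscaleE.
  by rewrite tensor_rscaleD !tensor_lscaleD tensor_rscaleD Ht Hu.
Qed.

Definition tensor_bimodule : bimodule R R' := Bimodule tensor_bimoduleP.

End Tensor.

Section CopowerBimodule.
Variables (R R' : comPzRingType) (K : choiceType) (M : bimodule R R').

Local Notation T := ({malg M[K]}).

Definition copower_lscale (r : R) : T -> T :=
  malg_lift (fun k m => << lscale r m *g k >>).
Definition copower_rscale (a : T) (r : R') : T :=
  malg_lift (fun k m => << rscale m r *g k >>) a.

Lemma copower_lscaleD r : {morph copower_lscale r : a b / a + b}.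
Proof.
have [[_ lD _ _] _ _] := bimoduleP M.
by apply: malg_liftD => k x y; rewrite lD monalgUD.
Qed.

Lemma copower_lscaleU r m k :
  copower_lscale r << m *g k >> = << lscale r m *g k >>.
Proof.
have [[_ lD _ _] _ _] := bimoduleP M.
by apply: malg_liftU => {m} k' x y; rewrite lD monalgUD.
Qed.

Lemma copower_rscaleD r : {morph copower_rscale^~ r : a b / a + b}.
Proof.
have [_ [_ rD _ _] _] := bimoduleP M.
by apply: malg_liftD => k x y; rewrite rD monalgUD.
Qed.

Lemma copower_rscaleU r m k :
  copower_rscale << m *g k >> r = << rscale m r *g k >>.
Proof.
have [_ [_ rD _ _] _] := bimoduleP M.
apply: (malg_liftU (h := fun k m => << rscale m r *g k >>)).
by move=> {m} k' x y; rewrite rD monalgUD.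
Qed.

Lemma copower_lscale0 r : copower_lscale r 0 = 0.
Proof. exact: morphD0 (copower_lscaleD r). Qed.

Lemma copower_rscale0 r : copower_rscale 0 r = 0.
Proof. exact: morphD0 (copower_rscaleD r). Qed.

Lemma copower_bimoduleP : is_bimodule copower_lscale copower_rscale.
Proof.
have [[lDl _ lM l1] [rDr _ rM r1] lr] := bimoduleP M.
split; [split|split|].
- move=> r s; apply: malg_gen_ind => [|a b Ha Hb|k x].
  + by rewrite !copower_lscale0 addr0.
  + by rewrite !copower_lscaleD Ha Hb addrACA.
  + by rewrite !copower_lscaleU lDl monalgUD.
- by move=> r a b; exact: copower_lscaleD.
- move=> r s; apply: malg_gen_ind => [|a b Ha Hb|k x].
  + by rewrite !copower_lscale0.
  + by rewrite !copower_lscaleD Ha Hb.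
  + by rewrite !copower_lscaleU lM.
- apply: malg_gen_ind => [|a b Ha Hb|k x].
  + exact: copower_lscale0.
  + by rewrite !copower_lscaleD Ha Hb.
  + by rewrite !copower_lscaleU l1.
- move=> + r s; apply: malg_gen_ind => [|a b Ha Hb|k x].
  + by rewrite !copower_rscale0 addr0.
  + by rewrite !copower_rscaleD Ha Hb addrACA.
  + by rewrite !copower_rscaleU rDr monalgUD.
- by move=> a b r; exact: copower_rscaleD.
- move=> + r s; apply: malg_gen_ind => [|a b Ha Hb|k x].
  + by rewrite !copower_rscale0.
  + by rewrite !copower_rscaleD Ha Hb.
  + by rewrite !copower_rscaleU rM.
- apply: malg_gen_ind => [|a b Ha Hb|k x].
  + exact: copower_rscale0.
  + by rewrite !copower_rscaleD Ha Hb.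
  + by rewrite !copower_rscaleU r1.
- move=> r + s; apply: malg_gen_ind => [|a b Ha Hb|k x].
  + by rewrite copower_rscale0 !copower_lscale0 copower_rscale0.
  + by rewrite copower_rscaleD !copower_lscaleD copower_rscaleD Ha Hb.
  + by rewrite copower_rscaleU !copower_lscaleU copower_rscaleU lr.
Qed.

Definition copower_bimodule : bimodule R R' := Bimodule copower_bimoduleP.

End CopowerBimodule.

(* The direct sum, over all [n]-simplices, of copies of the tensor product of
   [R] and [R'] over the integers; [chain_gen R R' s] is [s] as an element of
   this free bimodule. *)
Definition chain_bimodule (R : comPzRingType) (S : scat) (R' : comPzRingType)
    (n : nat) : bimodule R R' :=
  copower_bimodule (csimplex S n) (tensor_bimodule R R').

Definition chain_gen (R : comPzRingType) (S : scat) (R' : comPzRingType)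
    (n : nat) (A B : S) (s : hom A B n) : chain_bimodule R S R' n :=
  (<< tens 1 1 *g (Simplex s : csimplex S n) >>
    : {malg (tensor_bimodule R R')[csimplex S n]}).

Section AlgebraBimodules.
Variables (R R' : comPzRingType).
Variables (AA : nualgebra R) (BB : nualgebra R') (M : bimodule R R').

Definition is_alg_bimodule (l : AA -> M -> M) (r : M -> BB -> M) : Prop :=
  [/\ [/\ forall a a' m, l (a + a') m = l a m + l a' m,
          forall a m m', l a (m + m') = l a m + l a m',
          forall a a' m, l (nualg_mul a a') m = l a (l a' m),
          forall c a m, lscale c (l a m) = l (nualg_scale c a) m &
          forall c a m, l (nualg_scale c a) m = l a (lscale c m)],
      [/\ forall m b b', r m (b + b') = r m b + r m b',
          forall m m' b, r (m + m') b = r m b + r m' b,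
          forall m b b', r m (nualg_mul b b') = r (r m b) b',
          forall c m b, rscale (r m b) c = r m (nualg_scale c b) &
          forall c m b, r m (nualg_scale c b) = r (rscale m c) b] &
      [/\ forall a m b, l a (r m b) = r (l a m) b,
          forall a m c, l a (rscale m c) = rscale (l a m) c &
          forall c m b, lscale c (r m b) = r (lscale c m) b]].

Record alg_bimodule := AlgBimodule {
  lact : AA -> M -> M;
  ract : M -> BB -> M;
  alg_bimoduleP : is_alg_bimodule lact ract
}.

Definition s_unital (u : alg_bimodule) : Prop :=
  forall m : M, exists (e : AA) (e' : BB), lact u e m = m /\ ract u m e' = m.

End AlgebraBimodules.

(* The action of [f] on the left and of [g] on the right may be taken in either
   order, by the commutation clause of [is_alg_bimodule]. In the second clause
   the equalities of objects under which [f], [s] and [g] are composable have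
   been substituted. *)
Definition acts_by_composition (R R' : comPzRingType) (S : scat) (n : nat)
    (u : alg_bimodule (path_algebra R S) (path_algebra R' S)
           (chain_bimodule R S R' n)) : Prop :=
  (forall (X Y U V A B : S) (f : hom X Y 0) (g : hom U V 0) (s : hom A B n),
     V <> A \/ B <> X ->
     ract u (lact u (path_gen R f) (chain_gen R R' s)) (path_gen R' g) = 0) /\
  (forall (U A B Y : S) (f : hom B Y 0) (g : hom U A 0) (s : hom A B n),
     ract u (lact u (path_gen R f) (chain_gen R R' s)) (path_gen R' g) =
     chain_gen R R'
       (comp (comp (total_degen n f) s) (total_degen n g))).

(* Main.v *)
(** An [R[S]]-action is biadditive, so it is given by its values on pairs of a
    1-morphism and a simplex; these values come from a partially defined
    composition, whose associativity yields all the associativity axioms.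
    For uniqueness, let [s : A -> B].  The formula gives [id_B * s * id_A = s],
    and, the identities being idempotent, [id_B * s = s] and [s * id_A = s].
    Hence [f * s = f * s * id_A] and [s * g = id_B * s * g] are prescribed.
    The sum of the identities of the finitely many objects involved in a chain
    is a local unit for it. *)
From HB Require Import structures.
From mathcomp Require Import all_boot all_algebra.
From mathcomp Require Import boolp finmap.
From mathcomp.multinomials Require Import monalg.
Require Import Defs.

Set Implicit Arguments.
Unset Strict Implicit.
Unset Printing Implicit Defensive.

Import GRing.Theory.
Local Open Scope ring_scope.

(** * Convolution of finitely supported functions along a partial operation *)

Section MalgMap.
Variables (K : choiceType) (G H : zmodType) (phi : G -> H).
Hypothesis phiD : {morph phi : x y / x + y}.

(** The scalar actions [path_scale], [copower_lscale] and [copower_rscale] unfold to this, with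
    [phi] the multiplication by the scalar. *)
Definition malg_map : {malg G[K]} -> {malg H[K]} :=
  malg_lift (fun k x => << phi x *g k >>).

Lemma malg_mapD : {morph malg_map : a b / a + b}.
Proof. by apply: malg_liftD => k x y; rewrite phiD monalgUD. Qed.

Lemma malg_mapU x k : malg_map << x *g k >> = << phi x *g k >>.
Proof.
apply: (malg_liftU (h := fun k x => << phi x *g k >>)) => {x}k x y.
by rewrite phiD monalgUD.
Qed.

Lemma malg_map0 : malg_map 0 = 0.
Proof. exact: morphD0 malg_mapD. Qed.

End MalgMap.

Definition biadditive (U V W : zmodType) (b : U -> V -> W) : Prop :=
  (forall y, {morph b^~ y : x x' / x + x'}) /\
  (forall x, {morph b x : y y' / y + y'}).

(** The value 0 at [None] is what makes non-composable pairs contribute nothing; [path_term] is the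
    case of 1-morphisms. *)
Definition malg_term (K : choiceType) (G : zmodType) (c : G) (o : option K) :
    {malg G[K]} :=
  if o is Some k then << c *g k >> else 0.

Lemma malg_termD (K : choiceType) (G : zmodType) (o : option K) :
  {morph (fun c : G => malg_term c o) : x y / x + y}.
Proof. by case: o => [k|] x y /=; rewrite ?addr0 // monalgUD. Qed.

Section PartialConvolution.
Variables (K1 K2 K3 : choiceType) (G1 G2 G3 : zmodType).
Variables (b : G1 -> G2 -> G3) (p : K1 -> K2 -> option K3).
Hypothesis bD : biadditive b.

(* Written so that [path_mul] unfolds to [pconv *%R (@scomp S 0)]. *)
Definition pconv (a : {malg G1[K1]}) (c : {malg G2[K2]}) : {malg G3[K3]} :=
  malg_lift (fun k x => malg_lift (fun l y => malg_term (b x y) (p k l)) c) a.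

Lemma pconv_termDl c k :
  {morph (fun x => malg_lift (fun l y => malg_term (b x y) (p k l)) c)
   : x y / x + y}.
Proof.
move=> x y; rewrite /malg_lift -big_split /=; apply: eq_bigr => l _.
by rewrite bD.1 malg_termD.
Qed.

Lemma pconv_termDr x k l :
  {morph (fun y => malg_term (b x y) (p k l)) : y z / y + z}.
Proof. by move=> y z; rewrite bD.2 malg_termD. Qed.

Lemma pconvDl c : {morph pconv^~ c : a a' / a + a'}.
Proof. exact: malg_liftD (pconv_termDl c). Qed.

Lemma pconvDr a : {morph pconv a : c c' / c + c'}.
Proof.
move=> c c'; rewrite -big_split /=; apply: eq_bigr => k _.
exact: (malg_liftD (@pconv_termDr a@_k k)).
Qed.

Lemma pconvUU x k y l :
  pconv << x *g k >> << y *g l >> = malg_term (b x y) (p k l).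
Proof.
rewrite [LHS](malg_liftU (pconv_termDl _)).
exact: (malg_liftU (@pconv_termDr x k)).
Qed.

Lemma pconv0l c : pconv 0 c = 0.
Proof. exact: morphD0 (pconvDl c). Qed.

Lemma pconv0r a : pconv a 0 = 0.
Proof. exact: morphD0 (pconvDr a). Qed.

(** Both sides are biadditive in [a] and [c], and on generators [malg_map] changes only the
    coefficient. This and its right-hand analogue supply the clauses of [is_alg_bimodule] that
    involve scalars. *)
Lemma malg_map_pconvl (f1 : G1 -> G1) (f3 : G3 -> G3) a c :
  {morph f1 : x y / x + y} -> {morph f3 : x y / x + y} ->
  (forall x y, f3 (b x y) = b (f1 x) y) ->
  malg_map f3 (pconv a c) = pconv (malg_map f1 a) c.
Proof.
move=> f1D f3D f13; elim/malg_gen_ind: a => [|a a' Ha Ha'|k x].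
- by rewrite malg_map0 // !pconv0l malg_map0.
- by rewrite malg_mapD // !pconvDl malg_mapD // Ha Ha'.
elim/malg_gen_ind: c => [|c c' Hc Hc'|l y].
- by rewrite !pconv0r malg_map0.
- by rewrite !pconvDr malg_mapD // Hc Hc'.
rewrite malg_mapU // !pconvUU -f13.
by case: (p k l) => [?|] /=; rewrite (malg_mapU, malg_map0).
Qed.

Lemma malg_map_pconvr (f2 : G2 -> G2) (f3 : G3 -> G3) a c :
  {morph f2 : x y / x + y} -> {morph f3 : x y / x + y} ->
  (forall x y, f3 (b x y) = b x (f2 y)) ->
  malg_map f3 (pconv a c) = pconv a (malg_map f2 c).
Proof.
move=> f2D f3D f23; elim/malg_gen_ind: a => [|a a' Ha Ha'|k x].
- by rewrite !pconv0l malg_map0.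
- by rewrite !pconvDl malg_mapD // Ha Ha'.
elim/malg_gen_ind: c => [|c c' Hc Hc'|l y].
- by rewrite malg_map0 // !pconv0r malg_map0.
- by rewrite malg_mapD // !pconvDr malg_mapD // Hc Hc'.
rewrite malg_mapU // !pconvUU -f23.
by case: (p k l) => [?|] /=; rewrite (malg_mapU, malg_map0).
Qed.

End PartialConvolution.

(** By additivity in each argument it is enough to treat generators, where associativity separates
    into one identity for coefficients and one for indices. Four independent operations are allowed
    so that the left, right and mixed associativity of the actions are all instances. *)
Lemma pconvA (K1 K2 K3 K12 K23 K : choiceType)
    (G1 G2 G3 G12 G23 G : zmodType)
    (b : G12 -> G3 -> G) (b12 : G1 -> G2 -> G12)
    (b' : G1 -> G23 -> G) (b23 : G2 -> G3 -> G23)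
    (p : K12 -> K3 -> option K) (p12 : K1 -> K2 -> option K12)
    (p' : K1 -> K23 -> option K) (p23 : K2 -> K3 -> option K23) :
  biadditive b -> biadditive b12 -> biadditive b' -> biadditive b23 ->
  (forall x y z, b' x (b23 y z) = b (b12 x y) z) ->
  (forall k l m,
     obind (p' k) (p23 l m) = obind (fun kl => p kl m) (p12 k l)) ->
  forall a c d,
    pconv b' p' a (pconv b23 p23 c d) = pconv b p (pconv b12 p12 a c) d.
Proof.
move=> bD b12D b'D b23D bA pA a c d.
elim/malg_gen_ind: a => [|a a' Ha Ha'|k x].
- by rewrite !pconv0l.
- by rewrite !pconvDl // Ha Ha'.
elim/malg_gen_ind: c => [|c c' Hc Hc'|l y].
- by rewrite !(pconv0l, pconv0r).
- by rewrite !(pconvDl, pconvDr) // Hc Hc'.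
elim/malg_gen_ind: d => [|d d' Hd Hd'|m z].
- by rewrite !pconv0r.
- by rewrite !pconvDr // Hd Hd'.
rewrite !pconvUU //; have := pA k l m.
(* If one inner product is undefined, [pA] forces the outer product on the other side to be
   undefined too, so both sides vanish. *)
case: (p23 l m) => [u|]; case: (p12 k l) => [v|] /=.
- by rewrite !pconvUU // bA => ->.
- by rewrite pconvUU // pconv0l // => ->.
- by rewrite pconvUU // pconv0r // => <-.
- by rewrite pconv0l ?pconv0r.
Qed.

(** * Total degeneracy as a functor from 1-morphisms to n-simplices *)

Section TotalDegeneracy.
Variables (S : scat) (n : nat).

Definition sdegen (x : simplex S 0) : simplex S n :=
  Simplex (total_degen n (simplex_val x)).

Lemma total_degen_comp (A B C : S) (g : hom B C 0) (f : hom A B 0) :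
  total_degen n (comp g f) = comp (total_degen n g) (total_degen n f).
Proof. by elim: n => //= m ->; rewrite comp_degen. Qed.

Lemma total_degen_ident (A : S) : total_degen n (ident A 0) = ident A n.
Proof. by elim: n => //= m ->; rewrite ident_degen. Qed.

(** Degeneracies keep source and target, so composability is unaffected; on composable pairs this is
    functoriality. *)
Lemma scomp_sdegen x y :
  scomp (sdegen y) (sdegen x) = omap sdegen (scomp y x).
Proof.
case: x y => [A B f] [B' C g]; have [eB|nB] := pselect (B = B').
  by case: _ / eB in g *; rewrite !scompE /= /sdegen /= total_degen_comp.
by rewrite !scomp_none.
Qed.

Lemma scomp1s (x : simplex S n) : scomp (Simplex (ident (tgt x) n)) x = Some x.
Proof. by case: x => A B f; rewrite scompE comp1s. Qed.

Lemma scomps1 (x : simplex S n) : scomp x (Simplex (ident (src x) n)) = Some x.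
Proof. by case: x => A B f; rewrite scompE comps1. Qed.

End TotalDegeneracy.

(** * Existence: the actions on chains and their local units *)

Section ChainBimodule.
Variables (R R' : comPzRingType) (S : scat) (n : nat).

Local Notation TT := (tensor_bimodule R R').
Local Notation C := {malg TT[csimplex S n]}.
Local Notation P := {malg R[csimplex S 0]}.
Local Notation P' := {malg R'[csimplex S 0]}.

Definition lcomp (f : csimplex S 0) (s : csimplex S n) :
    option (csimplex S n) := scomp (sdegen n f) s.
Definition rcomp (s : csimplex S n) (g : csimplex S 0) :
    option (csimplex S n) := scomp s (sdegen n g).

Definition chain_lact : P -> C -> C :=
  pconv (@lscale R R' TT) lcomp.
Definition chain_ract : C -> P' -> C :=
  pconv (@rscale R R' TT) rcomp.

Lemma mul_biadditive (A : pzRingType) : biadditive (@GRing.mul A).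
Proof. by split=> [y x x'|x y y']; rewrite (mulrDl, mulrDr). Qed.

Lemma lscale_biadditive (M : bimodule R R') : biadditive (@lscale R R' M).
Proof. by have [[lDl lDr _ _] _ _] := bimoduleP M; split=> *. Qed.

Lemma rscale_biadditive (M : bimodule R R') : biadditive (@rscale R R' M).
Proof. by have [_ [rDr rDl _ _] _] := bimoduleP M; split=> *. Qed.

(** The index half of multiplicativity of the left action: [scompA] composes the two degenerate
    simplices first, and [scomp_sdegen] makes their composite degenerate. *)
Lemma lcomp_scomp (g f : csimplex S 0) s :
  obind (lcomp g) (lcomp f s) = obind (fun h => lcomp h s) (scomp g f).
Proof. by rewrite /lcomp scompA scomp_sdegen; case: (scomp g f). Qed.

Lemma rcomp_scomp s (g f : csimplex S 0) :
  obind (rcomp s) (scomp g f) = obind (fun t => rcomp t f) (rcomp s g).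
Proof. by rewrite /rcomp -scompA scomp_sdegen; case: (scomp g f). Qed.

Lemma lcomp_rcomp f s g :
  obind (lcomp f) (rcomp s g) = obind (fun t => rcomp t g) (lcomp f s).
Proof. exact: scompA. Qed.

Lemma chain_alg_bimoduleP :
  @is_alg_bimodule R R' (path_algebra R S) (path_algebra R' S)
    (chain_bimodule R S R' n) chain_lact chain_ract.
Proof.
have lB := lscale_biadditive TT; have rB := rscale_biadditive TT.
have [[_ _ lM _] [_ _ rM _] lr] := bimoduleP TT.
have mB := mul_biadditive R; have mB' := mul_biadditive R'.
have lZ c a m : malg_map (@lscale R R' TT c) (chain_lact a m) =
    chain_lact (malg_map ( *%R c) a) m.
  apply: (malg_map_pconvl lcomp lB) => //; [exact: mB.2|exact: lB.2].
(* Moving [c] past the coefficients of [a] uses commutativity of [R]. Comparing [lZ] with [lZ']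
   yields the clause balancing a scalar between algebra element and chain. *)
have lZ' c a m : malg_map (@lscale R R' TT c) (chain_lact a m) =
    chain_lact a (malg_map (@lscale R R' TT c) m).
  apply: (malg_map_pconvr lcomp lB) => [||x y]; try exact: lB.2.
  by rewrite -!lM mulrC.
have rZ c m b : malg_map ((@rscale R R' TT)^~ c) (chain_ract m b) =
    chain_ract m (malg_map ( *%R c) b).
  apply: (malg_map_pconvr rcomp rB) => [||x y]; [exact: mB'.2|exact: rB.1|].
  by rewrite mulrC rM.
have rZ' c m b : malg_map ((@rscale R R' TT)^~ c) (chain_ract m b) =
    chain_ract (malg_map ((@rscale R R' TT)^~ c) m) b.
  apply: (malg_map_pconvl rcomp rB) => [||x y]; try exact: rB.1.
  by rewrite -!rM mulrC.
split; split.
- by move=> a a' m; exact: pconvDl.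
- by move=> a m m'; exact: pconvDr.
- move=> a a' m; apply/esym.
  exact: (pconvA lB mB lB lB (fun x y z => esym (lM x y z)) lcomp_scomp).
- exact: lZ.
- by move=> c a m; exact: etrans (esym (lZ c a m)) (lZ' c a m).
- by move=> m b b'; exact: pconvDr.
- by move=> m m' b; exact: pconvDl.
- move=> m b b'; exact: (pconvA rB rB rB mB' rM rcomp_scomp).
- exact: rZ.
- by move=> c m b; exact: etrans (esym (rZ c m b)) (rZ' c m b).
- move=> a m b; exact: (pconvA rB lB lB rB lr lcomp_rcomp).
- move=> a m c; apply/esym.
  apply: (malg_map_pconvr lcomp lB) => [||x y]; try exact: rB.1.
  by rewrite lr.
- move=> c m b.
  apply: (malg_map_pconvl rcomp rB) => [||x y]; try exact: lB.2.
  by rewrite lr.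
Qed.

Definition chain_alg_bimodule :
    alg_bimodule (path_algebra R S) (path_algebra R' S)
      (chain_bimodule R S R' n) :=
  AlgBimodule chain_alg_bimoduleP.

Lemma chain_acts_by_composition : acts_by_composition chain_alg_bimodule.
Proof.
have lB := lscale_biadditive TT; have rB := rscale_biadditive TT.
have [[_ _ _ l1] [_ _ _ r1] _] := bimoduleP TT.
split=> [X Y U V A B f g s VAXB|U A B Y f g s] /=.
- rewrite /chain_lact [pconv _ _ _ _]pconvUU // l1 /lcomp.
  have [BX|nBX] := pselect (B = X); last first.
    by rewrite scomp_none // /chain_ract pconv0l.
  (* Here [f] does compose with [s], but the composite still has source [A], so [g] kills it. *)
  case: VAXB => [VA|/(_ BX)//]; case: _ / BX in f *.
  by rewrite scompE /= /chain_ract [pconv _ _ _ _]pconvUU // /rcomp scomp_none.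
- rewrite /chain_lact [pconv _ _ _ _]pconvUU // l1 /lcomp scompE /=.
  by rewrite /chain_ract [pconv _ _ _ _]pconvUU // r1 /rcomp scompE.
Qed.

Lemma chain_s_unital : s_unital chain_alg_bimodule.
Proof.
have lB := lscale_biadditive TT; have rB := rscale_biadditive TT.
have [[_ _ _ l1] [_ _ _ r1] _] := bimoduleP TT.
move=> m; pose O : choiceType := {classic S}.
pose idO (B : O) : csimplex S 0 := Simplex (ident (B : S) 0).
(* Each object must be listed once: a repeated identity would multiply its simplices by the number
   of repetitions. *)
pose ends (e : simplex S n -> S) : seq O :=
  undup [seq e k : O | k : csimplex S n <- msupp (m : C)].
exists (\sum_(B <- ends (@tgt S n)) (<< idO B >> : P)).
exists (\sum_(A <- ends (@src S n)) (<< idO A >> : P')).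
have mE := monalgE (m : C); split=> /=; rewrite /chain_lact /chain_ract.
- rewrite [in RHS]mE [in LHS]mE.
  rewrite (big_morph _ (pconvDr lcomp lB _) (pconv0r lcomp lB _)).
  apply: eq_big_seq => k kM.
  rewrite (big_morph _ (pconvDl lcomp lB _) (pconv0l lcomp lB _)).
  (* Of all the listed identities, only the one at the target of [k] composes with [k]. *)
  rewrite (bigD1_seq (tgt k : O)) ?undup_uniq //; last first.
    by rewrite mem_undup; apply/mapP; exists k.
  rewrite pconvUU // l1 /lcomp /sdegen /= total_degen_ident scomp1s.
  rewrite big1 ?addr0 // => B BN.
  rewrite pconvUU // /lcomp scomp_none // => E.
  by move: BN; rewrite E eqxx.
- rewrite [in RHS]mE [in LHS]mE.
  rewrite (big_morph _ (pconvDl rcomp rB _) (pconv0l rcomp rB _)).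
  apply: eq_big_seq => k kM.
  rewrite (big_morph _ (pconvDr rcomp rB _) (pconv0r rcomp rB _)).
  rewrite (bigD1_seq (src k : O)) ?undup_uniq //; last first.
    by rewrite mem_undup; apply/mapP; exists k.
  rewrite pconvUU // r1 /rcomp /sdegen /= total_degen_ident scomps1.
  rewrite big1 ?addr0 // => B BN.
  rewrite pconvUU // /rcomp scomp_none // => E.
  by move: BN; rewrite -E eqxx.
Qed.

End ChainBimodule.

(** * Uniqueness: reduction to 1-morphisms acting on simplices *)

Section Uniqueness.
Variables (R R' : comPzRingType) (S : scat) (n : nat).

Local Notation M := (chain_bimodule R S R' n).
Local Notation bimod := (alg_bimodule (path_algebra R S) (path_algebra R' S) M).

(** Coefficients are sums of pure tensors, and [tens x y] is [tens 1 1] scaled by [x] on the left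
    and [y] on the right. *)
Lemma chain_ind (Q : M -> Prop) :
  Q 0 -> (forall a b, Q a -> Q b -> Q (a + b)) ->
  (forall (A B : S) (s : hom A B n) x y,
     Q (lscale x (rscale (chain_gen R R' s) y))) ->
  forall m, Q m.
Proof.
move=> Q0 QD QG; apply: malg_gen_ind => // -[A B s].
apply: tensor_ind => [x y|t u Qt Qu]; last by rewrite monalgUD; exact: QD.
have /= := QG A B s x y.
rewrite /chain_gen copower_rscaleU copower_lscaleU /=.
by rewrite tensor_rscaleE tensor_lscaleE mulr1 mul1r.
Qed.

Lemma path_ind (T : comPzRingType) (Q : path_algebra T S -> Prop) :
  Q 0 -> (forall a b, Q a -> Q b -> Q (a + b)) ->
  (forall (X Y : S) (f : hom X Y 0) x, Q (nualg_scale x (path_gen T f))) ->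
  forall a, Q a.
Proof.
move=> Q0 QD QG; apply: malg_gen_ind => // -[X Y f] x.
have /= := QG X Y f x.
by rewrite /path_gen path_scaleU mulr1.
Qed.

(** Additivity and compatibility with scalars reduce each action to its values on generators; the
    axioms, being propositions, do not distinguish two structures with the same actions. *)
Lemma alg_bimodule_ext (u v : bimod) :
  (forall (X Y A B : S) (f : hom X Y 0) (s : hom A B n),
     lact u (path_gen R f) (chain_gen R R' s) =
     lact v (path_gen R f) (chain_gen R R' s)) ->
  (forall (X Y A B : S) (f : hom X Y 0) (s : hom A B n),
     ract u (chain_gen R R' s) (path_gen R' f) =
     ract v (chain_gen R R' s) (path_gen R' f)) ->
  u = v.
Proof.
case: u v => [l r lrP] [l' r' lrP'] /= El Er.
suff [El' Er'] : l = l' /\ r = r'.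
  by case: _ / El' in lrP' *; case: _ / Er' in lrP' *;
    rewrite (Prop_irrelevance lrP lrP').
have [[lDl lDr _ lZ lZ'] [rDr rDl _ rZ rZ'] [_ lR Lr]] := lrP.
have [[lDl' lDr' _ kZ kZ'] [rDr' rDl' _ qZ qZ'] [_ lR' Lr']] := lrP'.
split; apply/funext => a; apply/funext => b.
- elim/path_ind: a b => [b|a a' Ha Ha' b|X Y f c].
  + by rewrite (morphD0 (fun a a' => lDl a a' b))
      (morphD0 (fun a a' => lDl' a a' b)).
  + by rewrite lDl lDl' Ha Ha'.
  elim/chain_ind => [|m m' Hm Hm'|A B s x y].
  + by rewrite (morphD0 (lDr _)) (morphD0 (lDr' _)).
  + by rewrite lDr lDr' Hm Hm'.
  (* The scalar [c] comes out directly; [x], which sits on the chain, is first transferred to the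
     algebra element and then taken out; [y] commutes with the left action. *)
  by rewrite -lZ -kZ -lZ' -kZ' -lZ -kZ lR lR' El.
- elim/path_ind: b a => [a|b b' Hb Hb' a|X Y f c].
  + by rewrite (morphD0 (rDr _)) (morphD0 (rDr' _)).
  + by rewrite rDr rDr' Hb Hb'.
  elim/chain_ind => [|m m' Hm Hm'|A B s x y].
  + by rewrite (morphD0 (fun m m' => rDl m m' _))
      (morphD0 (fun m m' => rDl' m m' _)).
  + by rewrite rDl rDl' Hm Hm'.
  by rewrite -rZ -qZ -Lr -Lr' -rZ' -qZ' -rZ -qZ Er.
Qed.

Variable u : bimod.
Hypothesis uP : acts_by_composition u.

Lemma path_gen_idem (T : comPzRingType) (A : S) :
  nualg_mul (path_gen T (ident A 0)) (path_gen T (ident A 0)) =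
  path_gen T (ident A 0).
Proof.
by rewrite /= /path_gen path_mulUU scompE comp1s /= mulr1.
Qed.

Lemma acts_ident (A B : S) (s : hom A B n) :
  ract u (lact u (path_gen R (ident B 0)) (chain_gen R R' s))
    (path_gen R' (ident A 0)) = chain_gen R R' s.
Proof. by rewrite uP.2 !total_degen_ident comp1s comps1. Qed.

Lemma lact_ident (A B : S) (s : hom A B n) :
  lact u (path_gen R (ident B 0)) (chain_gen R R' s) = chain_gen R R' s.
Proof.
have [[_ _ lM _ _] _ [lr _ _]] := alg_bimoduleP u.
(* Only the chain acted upon is expanded by [acts_ident]; the two left identities then merge into
   one and the same formula contracts the result. *)
by rewrite -{1}[chain_gen R R' s]acts_ident lr -lM path_gen_idem acts_ident.
Qed.

Lemma ract_ident (A B : S) (s : hom A B n) :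
  ract u (chain_gen R R' s) (path_gen R' (ident A 0)) = chain_gen R R' s.
Proof. by rewrite -{1}[chain_gen R R' s]lact_ident acts_ident. Qed.

Lemma lactE (X Y A B : S) (f : hom X Y 0) (s : hom A B n) :
  lact u (path_gen R f) (chain_gen R R' s) =
  ract u (lact u (path_gen R f) (chain_gen R R' s)) (path_gen R' (ident A 0)).
Proof.
have [_ _ [lr _ _]] := alg_bimoduleP u.
by rewrite -lr ract_ident.
Qed.

Lemma ractE (X Y A B : S) (f : hom X Y 0) (s : hom A B n) :
  ract u (chain_gen R R' s) (path_gen R' f) =
  ract u (lact u (path_gen R (ident B 0)) (chain_gen R R' s)) (path_gen R' f).
Proof. by rewrite lact_ident. Qed.

End Uniqueness.

Lemma acts_by_composition_inj (R R' : comPzRingType) (S : scat) (n : nat)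
    (u v : alg_bimodule (path_algebra R S) (path_algebra R' S)
             (chain_bimodule R S R' n)) :
  acts_by_composition u -> acts_by_composition v -> u = v.
Proof.
move=> uP vP; have sandwich (X Y U V A B : S) (f : hom X Y 0) (g : hom U V 0)
    (s : hom A B n) :
    ract u (lact u (path_gen R f) (chain_gen R R' s)) (path_gen R' g) =
    ract v (lact v (path_gen R f) (chain_gen R R' s)) (path_gen R' g).
  (* The two clauses of [acts_by_composition] exhaust all cases, so every two-sided action on a
     generator is prescribed. *)
  have [BX|nBX] := pselect (B = X); last by rewrite uP.1 ?vP.1 //; right.
  have [VA|nVA] := pselect (V = A); last by rewrite uP.1 ?vP.1 //; left.
  case: _ / BX in f *; case: _ / VA in s *.
  by rewrite uP.2 vP.2.
apply: alg_bimodule_ext => X Y A B f s.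
- by rewrite (lactE uP) (lactE vP).
- by rewrite (ractE uP) (ractE vP).
Qed.

Theorem theorem14 (R R' : comPzRingType) (S : scat) (n : nat) :
  exists u : alg_bimodule (path_algebra R S) (path_algebra R' S)
               (chain_bimodule R S R' n),
    unique (@acts_by_composition R R' S n) u /\ s_unital u.
Proof.
exists (chain_alg_bimodule R R' S n); split; last exact: chain_s_unital.
split=> [|v]; first exact: chain_acts_by_composition.
exact: acts_by_composition_inj (@chain_acts_by_composition R R' S n).
Qed.
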